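(* Let $(s(0),v(0))\in\Omega$ and suppose that $$s_i(0)\ge\max\big(\lambda-\omega^{-1}(v_{i-1}(0)-v_i(0)),\ \lambda\big)\quad\text{for } i=2,\dots,n,$$ where $\omega=\mu+g(0)$. Then the solution of the microscopic inviscid ACC model with initial condition $(s(0),v(0))$ is given, for $t\ge 0$, by $$v_i(t)=v^*+\exp(-\omega t)\,(v_i(0)-v^* ),\quad i=1,\dots,n,$$ $$s_i(t)=s_i(0)+\omega^{-1}(v_{i-1}(0)-v_i(0))\,(1-\exp(-\omega t)),\quad i=2,\dots,n.$$
   Context: Notation: $\mathbb{R}_+=[0,+\infty)$. Let $n\ge 2$ be an integer and let $\mu>0$, $\lambda>L>0$, $v_{\max}>v^*>0$ be constants. Let $V\in C^2((L,+\infty);\mathbb{R}_+)$ satisfy: $\lim_{s\to L^+}V(s)=+\infty$; $V''(s)\ge 0$ for all $s>L$; $V(s)=0$ for all $s\ge\lambda$; $V'(s)<0$ for all $s\in(L,\lambda)$. Let $f\in C^1(\mathbb{R})$ be non-decreasing with $\max(x,0)\le f(x)$ for all $x\in\mathbb{R}$, and define $$g(x)=\frac{v_{\max}f(x)}{v^*(v_{\max}-v^* )}-\frac{x}{v^*},\quad x\in\mathbb{R}.$$ Define $k_1(s_2)=\mu+g(-V'(s_2))$, $k_i(s_i,s_{i+1})=\mu+g(V'(s_i)-V'(s_{i+1}))$ for $i=2,\dots,n-1$, and $k_n(s_n)=\mu+g(V'(s_n))$. The microscopic inviscid ACC model, with state $(s,v)$, $s=(s_2,\dots,s_n)\in\mathbb{R}^{n-1}$,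 $v=(v_1,\dots,v_n)\in\mathbb{R}^n$, is the ODE system $$\dot s_i=v_{i-1}-v_i,\quad i=2,\dots,n,$$ $$\dot v_1=-k_1(s_2)(v_1-v^* )-V'(s_2),$$ $$\dot v_i=-k_i(s_i,s_{i+1})(v_i-v^* )+V'(s_i)-V'(s_{i+1}),\quad i=2,\dots,n-1,$$ $$\dot v_n=-k_n(s_n)(v_n-v^* )+V'(s_n),$$ with state space $$\Omega=\Big\{(s_2,\dots,s_n,v_1,\dots,v_n)\in\mathbb{R}^{2n-1}:\ \min_{i=2,\dots,n}s_i>L,\ \max_{i=1,\dots,n}v_i\le v_{\max},\ \min_{i=1,\dots,n}v_i\ge 0\Big\}.$$ *)

(* Defs.v *)
From Stdlib Require Import Reals Lra Lia.
From Coquelicot Require Import Coquelicot.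

Open Scope R_scope.

(* Finite families (x_a, ..., x_b) are functions on nat that are only ever
   constrained, and only ever compared, at the indices a <= i <= b.  The indices
   are the 1-based ones of the model: s_2, ..., s_n and v_1, ..., v_n. *)

(* V is a total function on R, but is only ever constrained on (L, +oo);
   Derive V s depends only on V near s. *)
Definition admissible_potential (L lam : R) (V : R -> R) : Prop :=
  (forall s, L < s -> 0 <= V s) /\
  (forall s, L < s ->
     ex_derive V s /\ ex_derive (Derive V) s /\ continuous (Derive_n V 2) s) /\
  filterlim V (at_right L) (Rbar_locally p_infty) /\
  (forall s, L < s -> 0 <= Derive_n V 2 s) /\
  (forall s, lam <= s -> V s = 0) /\
  (forall s, L < s < lam -> Derive V s < 0).

Definition admissible_f (f : R -> R) : Prop :=
  (forall x, ex_derive f x /\ continuous (Derive f) x) /\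
  (forall x y, x <= y -> f x <= f y) /\
  (forall x, Rmax x 0 <= f x).

Definition g (vmax vstar : R) (f : R -> R) (x : R) : R :=
  vmax * f x / (vstar * (vmax - vstar)) - x / vstar.

Definition k_first (mu vmax vstar : R) (V f : R -> R) (s2 : R) : R :=
  mu + g vmax vstar f (- Derive V s2).

Definition k_mid (mu vmax vstar : R) (V f : R -> R) (si si1 : R) : R :=
  mu + g vmax vstar f (Derive V si - Derive V si1).

Definition k_last (mu vmax vstar : R) (V f : R -> R) (sn : R) : R :=
  mu + g vmax vstar f (Derive V sn).

Definition Omega (n : nat) (L vmax : R) (s v : nat -> R) : Prop :=
  (forall i, (2 <= i <= n)%nat -> L < s i) /\
  (forall i, (1 <= i <= n)%nat -> v i <= vmax) /\
  (forall i, (1 <= i <= n)%nat -> 0 <= v i).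

Definition time_interval (T : Rbar) (t : R) : Prop := 0 <= t /\ Rbar_lt t T.

(* A solution on [0, T), with T possibly +oo, as a curve in the state space
   Omega; s i t and v i t are the components at time t.  D_in x x' J t says that
   x' t is the derivative of x at t relative to J, so at t = 0 it is the right
   derivative, and values of the curve outside [0, T) are irrelevant. *)
Definition acc_solution (n : nat) (mu L vmax vstar : R) (V f : R -> R)
    (T : Rbar) (s v : nat -> R -> R) : Prop :=
  let J := time_interval T in
  let V' := Derive V in
  let k1 := k_first mu vmax vstar V f in
  let k := k_mid mu vmax vstar V f in
  let kn := k_last mu vmax vstar V f in
  forall t, J t ->
    Omega n L vmax (fun i => s i t) (fun i => v i t) /\
    (forall i, (2 <= i <= n)%nat ->
       D_in (s i) (fun u => v (i - 1)%nat u - v i u) J t) /\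
    D_in (v 1%nat)
      (fun u => - k1 (s 2%nat u) * (v 1%nat u - vstar) - V' (s 2%nat u)) J t /\
    (forall i, (2 <= i <= n - 1)%nat ->
       D_in (v i)
         (fun u => - k (s i u) (s (i + 1)%nat u) * (v i u - vstar)
                   + V' (s i u) - V' (s (i + 1)%nat u)) J t) /\
    D_in (v n) (fun u => - kn (s n u) * (v n u - vstar) + V' (s n u)) J t.

Definition initial_condition (n : nat) (s0 v0 : nat -> R) (s v : nat -> R -> R)
    : Prop :=
  (forall i, (2 <= i <= n)%nat -> s i 0 = s0 i) /\
  (forall i, (1 <= i <= n)%nat -> v i 0 = v0 i).

(* (s, v) is the solution for t >= 0: it is a global solution, and every
   solution with the same initial condition on some [0, T) is its restriction. *)
Definition is_the_acc_solution (n : nat) (mu L vmax vstar : R) (V f : R -> R)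
    (s0 v0 : nat -> R) (s v : nat -> R -> R) : Prop :=
  acc_solution n mu L vmax vstar V f p_infty s v /\
  initial_condition n s0 v0 s v /\
  forall (T : Rbar) (s' v' : nat -> R -> R),
    Rbar_lt 0 T ->
    acc_solution n mu L vmax vstar V f T s' v' ->
    initial_condition n s0 v0 s' v' ->
    forall t, time_interval T t ->
      (forall i, (2 <= i <= n)%nat -> s' i t = s i t) /\
      (forall i, (1 <= i <= n)%nat -> v' i t = v i t).

(* Main.v *)
Require Import Defs.
From Stdlib Require Import Reals Lra Lia.
From Coquelicot Require Import Coquelicot.

Open Scope R_scope.

(* As long as every headway is at least lam, the interaction terms vanish and
   every gain equals omega, so the system is linear with the stated solution,
   along which each headway moves monotonically between two values that are at
   least lam.  For uniqueness, a second solution has headways in a compact subset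
   of (L, +oo) on every [0, t], where V' and g o V' are Lipschitz; the squared
   distance to the explicit solution then satisfies a Gronwall inequality. *)

(** * Derivatives relative to a half-open time interval *)

Lemma is_derive_D_in (h dh : R -> R) (J : R -> Prop) (x : R) :
  is_derive h x (dh x) -> D_in h dh J x.
Proof.
  intros H.
  apply D_in_imp with no_cond; [intros y _; exact I|].
  now apply derivable_pt_lim_D_in, is_derive_Reals.
Qed.

Lemma time_interval_locally (T : Rbar) (x : R) :
  Rbar_lt x T -> exists d, 0 < d /\ forall y, Rabs (y - x) < d -> Rbar_lt y T.
Proof.
  destruct T as [r| |]; simpl; intros H.
  - exists (r - x); split; [lra|]. intros y Hy; apply Rabs_lt_between in Hy; lra.
  - now exists 1; split; [lra|].
  - contradiction.
Qed.

Lemma time_interval_le (T : Rbar) (t u : R) :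
  time_interval T t -> 0 <= u <= t -> time_interval T u.
Proof.
  intros [_ H] Hu; split; [lra|].
  apply Rbar_le_lt_trans with t; [simpl; lra|exact H].
Qed.

Lemma D_in_is_derive (h dh : R -> R) (T : Rbar) (x : R) :
  0 < x -> Rbar_lt x T -> D_in h dh (time_interval T) x -> is_derive h x (dh x).
Proof.
  intros Hx HT HD.
  apply is_derive_Reals, derivable_pt_lim_D_in.
  destruct (time_interval_locally T x HT) as [d [Hd Hloc]].
  intros eps Heps. destruct (HD eps Heps) as [a [Ha Hlim]].
  (* Radius [d] keeps [y] below [T] and radius [x] keeps it positive, so the whole two-sided
     neighbourhood lies in the interval. *)
  exists (Rmin a (Rmin d x)); split.
  { repeat apply Rmin_glb_lt; lra. }
  simpl in *; unfold Rdist in *.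
  intros y [[_ Hyx] Hy].
  pose proof (Rmin_l a (Rmin d x)); pose proof (Rmin_r a (Rmin d x)).
  pose proof (Rmin_l d x); pose proof (Rmin_r d x).
  apply Hlim; split; [|lra].
  split; [split|exact Hyx].
  - apply Rabs_lt_between in Hy; lra.
  - apply Hloc; lra.
Qed.

(* Extending by a constant to the left of 0 turns one-sided continuity at 0 into
   two-sided continuity, as the library's compactness theorems require. *)
Lemma D_in_continuity_pt_clamp (h dh : R -> R) (T : Rbar) (x : R) :
  time_interval T x -> D_in h dh (time_interval T) x ->
  continuity_pt (fun y => h (Rmax 0 y)) x.
Proof.
  intros [Hx HT] HD.
  destruct (time_interval_locally T x HT) as [d [Hd Hloc]].
  intros eps Heps. destruct (cont_deriv _ _ _ _ HD eps Heps) as [a [Ha Hlim]].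
  exists (Rmin a d); split; [apply Rmin_glb_lt; lra|].
  simpl in *; unfold Rdist in *.
  intros y [_ Hy].
  pose proof (Rmin_l a d); pose proof (Rmin_r a d).
  rewrite (Rmax_right 0 x Hx).
  assert (Hc : Rabs (Rmax 0 y - x) <= Rabs (y - x)).
  { unfold Rmax; destruct (Rle_dec 0 y); [lra|].
    rewrite !Rabs_left1; lra. }
  (* The relative limit is over points other than [x], so the case where the clamped point equals
     [x] is treated apart. *)
  destruct (Req_dec x (Rmax 0 y)) as [E|E].
  - rewrite <- E, Rminus_diag, Rabs_R0; exact Heps.
  - apply Hlim; repeat split; [apply Rmax_l|apply Hloc; lra|exact E|lra].
Qed.

(** * Monotonicity and Gronwall inequalities *)

Lemma D_in_nonincreasing (h dh : R -> R) (T : Rbar) (t : R) :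
  time_interval T t ->
  (forall u, 0 <= u <= t -> D_in h dh (time_interval T) u) ->
  (forall u, 0 <= u <= t -> dh u <= 0) ->
  h t <= h 0.
Proof.
  intros Ht HD Hneg.
  assert (H0 := proj1 Ht).
  (* The mean value theorem is applied to the clamped function, which agrees with [h] on [0, t] and
     is continuous in the two-sided sense at 0. *)
  destruct (MVT_gen (fun y => h (Rmax 0 y)) 0 t dh) as [c [Hc E]].
  - rewrite Rmin_left, Rmax_right by lra. intros x Hx.
    apply is_derive_ext_loc with h.
    + exists (mkposreal x (proj1 Hx)). intros y Hy.
      apply Rabs_lt_between in Hy; simpl in Hy.
      unfold minus, plus, opp in Hy; simpl in Hy.
      rewrite Rmax_right; lra.
    + apply D_in_is_derive with T; [lra| |apply HD; lra].
      apply (time_interval_le T t x Ht); lra.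
  - rewrite Rmin_left, Rmax_right by lra. intros x Hx.
    apply D_in_continuity_pt_clamp with dh T.
    + now apply time_interval_le with t.
    + now apply HD.
  - rewrite Rmin_left, Rmax_right in Hc by lra.
    rewrite (Rmax_right 0 t), (Rmax_left 0 0) in E by lra.
    specialize (Hneg c Hc). nra.
Qed.

(** Integrating factor: [h u * exp (- K * u)] has derivative [(dh u - K * h u) * exp (- K * u) <= 0]
    and starts at 0, so it is nonpositive at [t]. *)
Lemma gronwall_zero (h dh : R -> R) (K : R) (T : Rbar) (t : R) :
  time_interval T t ->
  (forall u, 0 <= u <= t -> D_in h dh (time_interval T) u) ->
  (forall u, 0 <= u <= t -> dh u <= K * h u) ->
  h 0 = 0 -> 0 <= h t -> h t = 0.
Proof.
  intros Ht HD Hle H0 Hpos.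
  assert (H := D_in_nonincreasing (fun u => h u * exp (- K * u))
    (fun u => dh u * exp (- K * u) + h u * (- K * exp (- K * u))) T t Ht).
  simpl in H. rewrite H0 in H.
  assert (h t * exp (- K * t) <= 0).
  { rewrite <- (Rmult_0_l (exp (- K * 0))). apply H.
    - intros u Hu.
      apply (Dmult (time_interval T) dh (fun u => - K * exp (- K * u))); [now apply HD|].
      apply is_derive_D_in. auto_derive; [trivial|ring].
    - intros u Hu. specialize (Hle u Hu).
      pose proof (exp_pos (- K * u)). nra. }
  pose proof (exp_pos (- K * t)). nra.
Qed.

Lemma D_in_sum (h dh : nat -> R -> R) (J : R -> Prop) (x : R) (N : nat) :
  (forall j, (j <= N)%nat -> D_in (h j) (dh j) J x) ->
  D_in (fun u => sum_f_R0 (fun j => h j u) N)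
       (fun u => sum_f_R0 (fun j => dh j u) N) J x.
Proof.
  induction N as [|N IH]; intros H; simpl.
  - now apply (H 0%nat).
  - apply (Dadd J (fun u => sum_f_R0 (fun j => dh j u) N) (dh (S N))).
    + apply IH; intros j Hj; apply H; lia.
    + apply H; lia.
Qed.

Lemma sum_f_R0_ge_0 (a : nat -> R) (N : nat) :
  (forall j, (j <= N)%nat -> 0 <= a j) -> 0 <= sum_f_R0 a N.
Proof.
  intros H; induction N as [|N IH]; simpl; [now apply H|].
  apply Rplus_le_le_0_compat; [apply IH; intros j Hj; apply H|apply H]; lia.
Qed.

Lemma sum_f_R0_ge_term (a : nat -> R) (N i : nat) :
  (forall j, (j <= N)%nat -> 0 <= a j) -> (i <= N)%nat -> a i <= sum_f_R0 a N.
Proof.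
  intros H Hi; induction N as [|N IH]; simpl.
  - replace i with 0%nat by lia; lra.
  - assert (HS : 0 <= a (S N)) by (apply H; lia).
    destruct (Nat.eq_dec i (S N)) as [->|Hne].
    + assert (0 <= sum_f_R0 a N) by (apply sum_f_R0_ge_0; intros j Hj; apply H; lia).
      lra.
    + assert (a i <= sum_f_R0 a N) by (apply IH; [intros j Hj; apply H|]; lia).
      lra.
Qed.

(** Adding the [N + 1] inequalities gives Gronwall for the sum, with constant [K * INR (S N)]. A
    vanishing sum of nonnegative terms has only zero terms. *)
Lemma gronwall_zero_family (e de : nat -> R -> R) (K : R) (N : nat)
    (T : Rbar) (t : R) :
  time_interval T t ->
  (forall j u, (j <= N)%nat -> 0 <= u <= t -> D_in (e j) (de j) (time_interval T) u) ->
  (forall j u, (j <= N)%nat -> 0 <= u <= t -> 0 <= e j u) ->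
  (forall j u, (j <= N)%nat -> 0 <= u <= t ->
     de j u <= K * sum_f_R0 (fun k => e k u) N) ->
  (forall j, (j <= N)%nat -> e j 0 = 0) ->
  forall j, (j <= N)%nat -> e j t = 0.
Proof.
  intros Ht HD Hpos Hle H0 j Hj.
  assert (Ht0 := proj1 Ht).
  assert (Hz : sum_f_R0 (fun k => e k t) N = 0).
  { apply (gronwall_zero (fun u => sum_f_R0 (fun k => e k u) N)
             (fun u => sum_f_R0 (fun k => de k u) N) (K * INR (S N)) T t Ht).
    - intros u Hu. apply D_in_sum. intros k Hk; now apply HD.
    - intros u Hu.
      apply Rle_trans with
        (sum_f_R0 (fun _ => K * sum_f_R0 (fun k => e k u) N) N).
      + apply sum_Rle; intros k Hk; now apply Hle.
      + rewrite sum_cte; lra.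
    - rewrite (sum_eq _ (fun _ => 0)) by exact H0. rewrite sum_cte; ring.
    - apply sum_f_R0_ge_0; intros k Hk; apply Hpos; [exact Hk|lra]. }
  apply Rle_antisym; [|apply Hpos; [exact Hj|lra]].
  rewrite <- Hz. apply (sum_f_R0_ge_term (fun k => e k t)); [|exact Hj].
  intros k Hk; apply Hpos; [exact Hk|lra].
Qed.

(** * Compactness: Lipschitz constants and uniform lower bounds *)

Lemma C1_lipschitz (h : R -> R) (a b : R) :
  a <= b ->
  (forall x, a <= x <= b -> ex_derive h x /\ continuous (Derive h) x) ->
  exists K, 0 <= K /\
    forall x y, a <= x <= b -> a <= y <= b -> Rabs (h x - h y) <= K * Rabs (x - y).
Proof.
  intros Hab H.
  (* The Lipschitz constant is the maximum of the absolute derivative over [a, b], attained at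
     [M]. *)
  destruct (continuity_ab_maj (fun x => Rabs (Derive h x)) a b Hab) as [M [HM _]].
  { intros c Hc. apply continuity_pt_filterlim.
    apply continuous_Rabs_comp. now apply H. }
  exists (Rabs (Derive h M)); split; [apply Rabs_pos|].
  intros x y Hx Hy.
  assert (Hin : forall c, Rmin y x <= c <= Rmax y x -> a <= c <= b).
  { intros c Hc. unfold Rmin, Rmax in Hc; destruct (Rle_dec y x); lra. }
  destruct (MVT_gen h y x (Derive h)) as [c [Hc E]].
  - intros c Hc. apply Derive_correct, H, Hin; lra.
  - intros c Hc. apply continuity_pt_filterlim.
    apply (ex_derive_continuous h c), H, Hin, Hc.
  - rewrite E, Rabs_mult.
    apply Rmult_le_compat_r; [apply Rabs_pos|]. now apply HM, Hin.
Qed.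

(** Each component attains its minimum on the compact [0, t], so that minimum still exceeds [L];
    induction on [n] takes the least of finitely many. This keeps headways away from the singularity
    of [V] at [L]. For an empty index range any bound above [L] serves. *)
Lemma D_in_family_lower_bound (h dh : nat -> R -> R) (L t : R) (T : Rbar) (a n : nat) :
  time_interval T t ->
  (forall i u, (a <= i <= n)%nat -> 0 <= u <= t ->
     D_in (h i) (dh i) (time_interval T) u /\ L < h i u) ->
  exists m, L < m /\
    forall i u, (a <= i <= n)%nat -> 0 <= u <= t -> m <= h i u.
Proof.
  intros Ht. assert (Ht0 := proj1 Ht).
  induction n as [|n IH]; intros H.
  all: assert (Hone : forall i, (forall u, 0 <= u <= t ->
         D_in (h i) (dh i) (time_interval T) u /\ L < h i u) ->
         exists m, L < m /\ forall u, 0 <= u <= t -> m <= h i u).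
  1, 3: intros i Hi;
    destruct (continuity_ab_min (fun y => h i (Rmax 0 y)) 0 t Ht0) as [x [Hx Hxt]];
    [ intros c Hc; apply D_in_continuity_pt_clamp with (dh i) T;
        [now apply time_interval_le with t|now apply Hi]
    | exists (h i x); split; [now apply Hi|];
      intros u Hu; specialize (Hx u Hu); now rewrite !Rmax_right in Hx by lra ].
  - destruct a as [|a].
    + destruct (Hone 0%nat) as [m [Hm Hle]]; [intros u Hu; now apply H|].
      exists m; split; [exact Hm|]. intros i u Hi. replace i with 0%nat by lia. apply Hle.
    + exists (L + 1); split; [lra|]. intros i u Hi; lia.
  - destruct IH as [m [Hm Hle]]; [intros i u Hi; apply H; lia|].
    destruct (Compare_dec.le_dec a (S n)) as [Ha|Ha].
    + destruct (Hone (S n)) as [m' [Hm' Hle']]; [intros u Hu; apply H; [lia|exact Hu]|].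
      exists (Rmin m m'); split; [now apply Rmin_glb_lt|].
      intros i u Hi Hu.
      destruct (Nat.eq_dec i (S n)) as [->|Hne].
      * apply Rle_trans with m'; [apply Rmin_r|now apply Hle'].
      * apply Rle_trans with m; [apply Rmin_l|apply Hle; [lia|exact Hu]].
    + exists m; split; [exact Hm|]. intros i u Hi; lia.
Qed.

(** * The potential beyond [lam], and the gain function *)

Lemma Derive_potential_eq_0 (L lam : R) (V : R -> R) (x : R) :
  L < lam -> admissible_potential L lam V -> lam <= x -> Derive V x = 0.
Proof.
  intros HL (_ & Hd & _ & _ & H0 & _) Hx.
  destruct (Hd x) as [Hex _]; [lra|].
  apply Derive_correct, (proj1 (is_derive_Reals _ _ _)) in Hex.
  set (l := Derive V x) in *.
  destruct (Req_dec l 0) as [E|E]; [exact E|exfalso].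
  (* The forward difference quotient with step [d / 2] is 0, yet should be within [Rabs l] of [l].
     Only points to the right of [x] are used, which covers [x = lam]. *)
  destruct (Hex (Rabs l) (Rabs_pos_lt l E)) as [d Hdlt].
  pose proof (cond_pos d) as Hd0.
  assert (A : Rabs ((V (x + d / 2) - V x) / (d / 2) - l) < Rabs l).
  { apply Hdlt; [lra|]. rewrite Rabs_right; lra. }
  rewrite !H0 in A by lra.
  replace ((0 - 0) / (d / 2) - l) with (- l) in A by (field; lra).
  rewrite Rabs_Ropp in A; lra.
Qed.

(** [Derive V] is Lipschitz between [m] and [lam] and vanishes at [lam]; a point [y >= lam] is at
    least as far from [x < lam] as [lam] is. Thus the force is controlled by the distance to any
    free-flow headway. *)
Lemma Derive_potential_bound (L lam m : R) (V : R -> R) :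
  L < lam -> L < m -> admissible_potential L lam V ->
  exists K, 0 <= K /\ forall x y, m <= x -> lam <= y ->
    Rabs (Derive V x) <= K * Rabs (x - y) /\ Rabs (Derive V x) <= K.
Proof.
  intros HL Hm HV.
  destruct (C1_lipschitz (Derive V) (Rmin m lam) lam (Rmin_r _ _)) as [K [HK Hlip]].
  { intros x Hx. destruct HV as (_ & Hd & _).
    apply Hd. apply Rlt_le_trans with (Rmin m lam); [now apply Rmin_glb_lt|lra]. }
  (* The summand 1 gives the Lipschitz bound. The other gives the uniform one, since
     [Rabs (x - lam) <= Rabs (m - lam)] when [m <= x < lam]. *)
  exists (K * (1 + Rabs (m - lam))).
  pose proof (Rabs_pos (m - lam)).
  split; [nra|]. intros x y Hx Hy.
  destruct (Rle_lt_dec lam x) as [Hlx|Hlx].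
  - rewrite (Derive_potential_eq_0 L lam V x HL HV Hlx), Rabs_R0.
    pose proof (Rabs_pos (x - y)). split; [|nra].
    apply Rmult_le_pos; nra.
  - assert (A : Rabs (Derive V x) <= K * Rabs (x - lam)).
    { replace (Derive V x) with (Derive V x - Derive V lam).
      - apply Hlip; unfold Rmin; destruct (Rle_dec m lam); lra.
      - rewrite (Derive_potential_eq_0 L lam V lam HL HV); lra. }
    rewrite (Rabs_left1 (x - y)) by lra.
    rewrite (Rabs_left1 (x - lam)) in A by lra.
    rewrite (Rabs_left1 (m - lam)) in * by lra.
    split; [|nra].
    apply Rle_trans with (K * - (x - y)); [nra|].
    apply Rmult_le_compat_r; [lra|nra].
Qed.

Lemma g_C1 (vmax vstar : R) (f : R -> R) (x : R) :
  admissible_f f ->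
  ex_derive (g vmax vstar f) x /\ continuous (Derive (g vmax vstar f)) x.
Proof.
  intros (Hf & _).
  assert (D : forall y, is_derive (g vmax vstar f) y
            (vmax * Derive f y * / (vstar * (vmax - vstar)) - / vstar)).
  { intros y. unfold g, Rdiv. pose proof (proj1 (Hf y)).
    auto_derive; [exact H|]. rewrite (Derive_ext _ f) by reflexivity. ring. }
  split; [eexists; apply D|].
  apply (continuous_ext
    (fun y => vmax * Derive f y * / (vstar * (vmax - vstar)) - / vstar)).
  { intros y; symmetry; apply is_derive_unique, D. }
  apply (continuous_minus (V := R_NormedModule)); [|apply continuous_const].
  apply (continuous_mult (K := R_AbsRing)); [|apply continuous_const].
  apply (continuous_mult (K := R_AbsRing)); [apply continuous_const|apply Hf].
Qed.

(** The lower bound on [f] gives [f 0 >= 0], hence [g 0 >= 0], and [mu] supplies strictness. *)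
Lemma omega_pos (mu vmax vstar : R) (f : R -> R) :
  0 < mu -> 0 < vstar < vmax -> admissible_f f -> 0 < mu + g vmax vstar f 0.
Proof.
  intros Hmu Hv (_ & _ & Hf). unfold g, Rdiv.
  specialize (Hf 0). rewrite Rmax_left in Hf by lra.
  assert (0 < / (vstar * (vmax - vstar))) by (apply Rinv_0_lt_compat; nra).
  assert (0 <= vmax * f 0) by nra. nra.
Qed.

(** * Uniform form of the velocity equations *)

(* With V' read as 0 on the missing gaps in front of vehicle 1 and behind
   vehicle n, all n velocity equations take the form of the middle ones. *)
Definition gap_force (n : nat) (V : R -> R) (i : nat) (x : R) : R :=
  if andb (2 <=? i)%nat (i <=? n)%nat then Derive V x else 0.

Lemma gap_force_in (n i : nat) (V : R -> R) (x : R) :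
  (2 <= i <= n)%nat -> gap_force n V i x = Derive V x.
Proof.
  intros [H1 H2]; unfold gap_force.
  now rewrite (proj2 (Nat.leb_le 2 i) H1), (proj2 (Nat.leb_le i n) H2).
Qed.

Lemma gap_force_out (n i : nat) (V : R -> R) (x : R) :
  ~ (2 <= i <= n)%nat -> gap_force n V i x = 0.
Proof.
  intros H; unfold gap_force.
  destruct (Nat.leb_spec 2 i), (Nat.leb_spec i n); simpl; try reflexivity; lia.
Qed.

(** This one quantity is both the interaction term of vehicle [i] and the argument of [g] in its
    gain. *)
Definition net_force (n : nat) (V : R -> R) (s : nat -> R -> R) (i : nat) (u : R) : R :=
  gap_force n V i (s i u) - gap_force n V (S i) (s (S i) u).

Lemma acc_solution_velocity (n : nat) (mu L vmax vstar : R) (V f : R -> R)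
    (T : Rbar) (s v : nat -> R -> R) (t : R) (i : nat) :
  acc_solution n mu L vmax vstar V f T s v -> time_interval T t ->
  (2 <= n)%nat -> (1 <= i <= n)%nat ->
  D_in (v i) (fun u => - (mu + g vmax vstar f (net_force n V s i u)) * (v i u - vstar)
                       + net_force n V s i u) (time_interval T) t.
Proof.
  intros Hsol Ht Hn Hi.
  destruct (Hsol t Ht) as (_ & _ & H1 & Hm & Hl).
  unfold net_force.
  destruct (Nat.eq_dec i 1) as [->|Hi1]; [|destruct (Nat.eq_dec i n) as [->|Hin]].
  - eapply D_in_ext; [|exact H1]. simpl.
    rewrite gap_force_out, gap_force_in by lia.
    unfold k_first. rewrite !Rminus_0_l. ring.
  - eapply D_in_ext; [|exact Hl]. simpl.
    rewrite gap_force_in, gap_force_out by lia.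
    unfold k_last. rewrite !Rminus_0_r. ring.
  - eapply D_in_ext; [|exact (Hm i ltac:(lia))]. simpl.
    rewrite !gap_force_in by lia.
    unfold k_mid. rewrite Nat.add_1_r. ring.
Qed.

(** Lets the global explicit solution be compared with one living only on [0, T): a relative
    derivative survives shrinking the set. *)
Lemma acc_solution_restrict (n : nat) (mu L vmax vstar : R) (V f : R -> R)
    (T : Rbar) (s v : nat -> R -> R) :
  acc_solution n mu L vmax vstar V f p_infty s v ->
  acc_solution n mu L vmax vstar V f T s v.
Proof.
  intros H t [Ht _].
  assert (Hsub : forall u, time_interval T u -> time_interval p_infty u)
    by (intros u [Hu _]; now split).
  destruct (H t (conj Ht I)) as (HO & Hs & H1 & Hm & Hl).
  split; [exact HO|split; [|split; [|split]]].
  - intros i Hi. exact (D_in_imp _ _ _ _ _ Hsub (Hs i Hi)).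
  - exact (D_in_imp _ _ _ _ _ Hsub H1).
  - intros i Hi. exact (D_in_imp _ _ _ _ _ Hsub (Hm i Hi)).
  - exact (D_in_imp _ _ _ _ _ Hsub Hl).
Qed.

(** Here [z] stands for the headway deviation. The first bound confines the argument of [g] to a
    compact interval; the second feeds the Gronwall estimate. *)
Lemma net_force_bound (n : nat) (V : R -> R) (s z : nat -> R -> R) (K u : R) (i : nat) :
  0 <= K ->
  (forall j, (2 <= j <= n)%nat ->
     Rabs (Derive V (s j u)) <= K * Rabs (z j u) /\ Rabs (Derive V (s j u)) <= K) ->
  Rabs (net_force n V s i u) <= 2 * K /\
  forall S2, 0 <= S2 -> (forall j, (2 <= j <= n)%nat -> (z j u) ^ 2 <= S2) ->
    (net_force n V s i u) ^ 2 <= 4 * K ^ 2 * S2.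
Proof.
  intros HK H.
  assert (B : forall j, Rabs (gap_force n V j (s j u)) <= K /\
    forall S2, 0 <= S2 -> (forall j, (2 <= j <= n)%nat -> (z j u) ^ 2 <= S2) ->
    (gap_force n V j (s j u)) ^ 2 <= K ^ 2 * S2).
  { intros j.
    destruct (Compare_dec.le_dec 2 j) as [H2|H2];
      [destruct (Compare_dec.le_dec j n) as [Hn|Hn]|].
    1: { rewrite gap_force_in by lia. destruct (H j ltac:(lia)) as [Ha Hb].
         split; [exact Hb|]. intros S2 HS Hz. specialize (Hz j ltac:(lia)).
         rewrite <- (pow2_abs (z j u)) in Hz. rewrite <- pow2_abs.
         apply Rle_trans with ((K * Rabs (z j u)) ^ 2).
         - apply pow_incr; split; [apply Rabs_pos|exact Ha].
         - rewrite Rpow_mult_distr. apply Rmult_le_compat_l; [nra|exact Hz]. }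
    all: rewrite gap_force_out by lia; split; [rewrite Rabs_R0; lra|intros; nra]. }
  unfold net_force. destruct (B i) as [A1 A2], (B (S i)) as [B1 B2].
  split.
  - apply Rabs_le_between in A1, B1. apply Rabs_le_between. lra.
  - intros S2 HS Hz. specialize (A2 S2 HS Hz). specialize (B2 S2 HS Hz).
    set (p := gap_force n V i (s i u)) in *.
    set (q := gap_force n V (S i) (s (S i) u)) in *.
    (* This is [(p - q)^2 <= 2 * p^2 + 2 * q^2], whence the factor 4. *)
    pose proof (pow2_ge_0 (p + q)). nra.
Qed.

(** * Uniqueness against a solution in free flow *)

Lemma acc_solution_free_flow_unique (n : nat) (mu lam L vmax vstar : R)
    (V f : R -> R) (T : Rbar) (s v s' v' : nat -> R -> R) (t : R) :
  (2 <= n)%nat -> L < lam -> 0 < vstar < vmax ->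
  0 <= mu + g vmax vstar f 0 ->
  admissible_potential L lam V -> admissible_f f ->
  acc_solution n mu L vmax vstar V f T s v ->
  (forall i u, (2 <= i <= n)%nat -> 0 <= u -> lam <= s i u) ->
  acc_solution n mu L vmax vstar V f T s' v' ->
  (forall i, (2 <= i <= n)%nat -> s' i 0 = s i 0) ->
  (forall i, (1 <= i <= n)%nat -> v' i 0 = v i 0) ->
  time_interval T t ->
  (forall i, (2 <= i <= n)%nat -> s' i t = s i t) /\
  (forall i, (1 <= i <= n)%nat -> v' i t = v i t).
Proof.
  intros Hn HL Hv Hom HV Hf Hsol Hfree Hsol' Hs0 Hv0 Ht.
  set (omega := mu + g vmax vstar f 0) in *.
  assert (Ht0 := proj1 Ht).
  assert (HJ : forall u, 0 <= u <= t -> time_interval T u)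
    by (intros u Hu; now apply time_interval_le with t).
  destruct (D_in_family_lower_bound s' (fun i u => v' (i - 1)%nat u - v' i u) L t T 2 n Ht)
    as [m [Hm Hlow]].
  { intros i u Hi Hu. destruct (Hsol' u (HJ u Hu)) as ((HO & _) & Hd & _).
    split; [now apply Hd|now apply HO]. }
  destruct (Derive_potential_bound L lam m V HL Hm HV) as [K1 [HK1 HV']].
  (* This interval contains 0 and, by [net_force_bound], every net force of the second solution up
     to time [t]. *)
  destruct (C1_lipschitz (g vmax vstar f) (- (2 * K1)) (2 * K1)) as [K2 [HK2 Hg]].
  { lra. }
  { intros x _; now apply g_C1. }
  set (z := fun i u => s' i u - s i u).
  set (w := fun i u => v' i u - v i u).
  set (x := fun i u => net_force n V s' i u).
  (* Difference of the two velocity equations, with the net force of the free-flow solution already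
     replaced by 0. *)
  set (dw := fun i u => - (mu + g vmax vstar f (x i u)) * (v' i u - vstar) + x i u
                        + omega * (v i u - vstar)).
  (* There is no headway 1; padding by 0 pairs every velocity deviation with a headway deviation. *)
  set (zz := fun i u => if Nat.leb i 1 then 0 else z i u).
  set (dzz := fun i u => if Nat.leb i 1 then 0 else w (i - 1)%nat u - w i u).
  (* The Gronwall family counts from 0 to [n - 1], so [e j] belongs to vehicle [S j]. *)
  set (e := fun j u => w (S j) u * w (S j) u + zz (S j) u * zz (S j) u).
  set (de := fun j u => (dw (S j) u * w (S j) u + w (S j) u * dw (S j) u)
                      + (dzz (S j) u * zz (S j) u + zz (S j) u * dzz (S j) u)).
  assert (Hzz : forall i u, (2 <= i)%nat -> zz i u = z i u).
  { intros i u Hi; unfold zz. destruct (Nat.leb_spec i 1); [lia|reflexivity]. }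
  assert (Hdzz : forall i u, (2 <= i)%nat -> dzz i u = w (i - 1)%nat u - w i u).
  { intros i u Hi; unfold dzz. destruct (Nat.leb_spec i 1); [lia|reflexivity]. }
  assert (HDw : forall i u, (1 <= i <= n)%nat -> 0 <= u <= t ->
            D_in (w i) (dw i) (time_interval T) u).
  { intros i u Hi Hu.
    pose proof (acc_solution_velocity _ _ _ _ _ _ _ _ _ _ u i Hsol (HJ u Hu) Hn Hi) as D.
    pose proof (acc_solution_velocity _ _ _ _ _ _ _ _ _ _ u i Hsol' (HJ u Hu) Hn Hi) as D'.
    eapply D_in_ext; [|exact (Dminus _ _ _ _ _ _ D' D)].
    assert (Hx0 : net_force n V s i u = 0).
    { assert (G : forall j, gap_force n V j (s j u) = 0).
      { intros j. destruct (Compare_dec.le_dec 2 j) as [H2|H2];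
          [destruct (Compare_dec.le_dec j n) as [H3|H3]|].
        - rewrite gap_force_in by lia.
          apply (Derive_potential_eq_0 L lam V _ HL HV). apply Hfree; [lia|lra].
        - apply gap_force_out; lia.
        - apply gap_force_out; lia. }
      unfold net_force; rewrite !G; ring. }
    simpl. rewrite Hx0. unfold dw, omega, x. ring. }
  assert (HDz : forall i u, (1 <= i <= n)%nat -> 0 <= u <= t ->
            D_in (zz i) (dzz i) (time_interval T) u).
  { intros i u Hi Hu. unfold zz, dzz.
    destruct (Nat.leb_spec i 1) as [Hi1|Hi1]; [apply Dconst|].
    destruct (Hsol u (HJ u Hu)) as (_ & Hd & _).
    destruct (Hsol' u (HJ u Hu)) as (_ & Hd' & _).
    eapply D_in_ext; [|exact (Dminus _ _ _ _ _ _ (Hd' i ltac:(lia)) (Hd i ltac:(lia)))].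
    simpl; unfold w; ring. }
  assert (Hpos : forall j u, 0 <= e j u).
  { intros j u; unfold e. nra. }
  assert (Hz : forall j, (j <= n - 1)%nat -> e j t = 0).
  (* The 6 is 1 from [Hwpart] plus 5 from [Hzpart]; the rest bounds the squared remainder [r]. *)
  { apply (gronwall_zero_family e de (6 + 4 * (1 + K2 * vmax) ^ 2 * K1 ^ 2) (n - 1) T t Ht).
    - intros j u Hj Hu. unfold e, de.
      apply (Dadd (time_interval T)
        (fun u => dw (S j) u * w (S j) u + w (S j) u * dw (S j) u)
        (fun u => dzz (S j) u * zz (S j) u + zz (S j) u * dzz (S j) u)).
      + apply (Dmult (time_interval T) (dw (S j)) (dw (S j)));
          apply HDw; try exact Hu; lia.
      + apply (Dmult (time_interval T) (dzz (S j)) (dzz (S j)));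
          apply HDz; try exact Hu; lia.
    - intros; apply Hpos.
    - intros j u Hj Hu.
      set (S2 := sum_f_R0 (fun k => e k u) (n - 1)).
      assert (HS : forall i, (1 <= i <= n)%nat -> w i u ^ 2 + zz i u ^ 2 <= S2).
      { intros i Hi. replace (w i u ^ 2 + zz i u ^ 2) with (e (i - 1)%nat u).
        - apply (sum_f_R0_ge_term (fun k => e k u)); [intros k _; apply Hpos|lia].
        - unfold e. replace (S (i - 1)) with i by lia. ring. }
      assert (HS0 : 0 <= S2).
      { apply sum_f_R0_ge_0; intros k _; apply Hpos. }
      destruct (net_force_bound n V s' z K1 u (S j) HK1) as [Hxb Hxs].
      { intros i Hi. apply HV'; [now apply Hlow|apply Hfree; [exact Hi|lra]]. }
      specialize (Hxs S2 HS0).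
      fold (x (S j) u) in Hxb, Hxs.
      assert (Hxs' : x (S j) u ^ 2 <= 4 * K1 ^ 2 * S2).
      { apply Hxs. intros i Hi. pose proof (HS i ltac:(lia)) as A.
        rewrite Hzz in A by lia. pose proof (pow2_ge_0 (w i u)). lra. }
      assert (Hvb : Rabs (v' (S j) u - vstar) <= vmax).
      { destruct (Hsol' u (HJ u Hu)) as ((_ & Hup & Hlo) & _).
        specialize (Hup (S j) ltac:(lia)). specialize (Hlo (S j) ltac:(lia)).
        simpl in Hup, Hlo. apply Rabs_le_between; lra. }
      assert (Hgx : Rabs (g vmax vstar f (x (S j) u) - g vmax vstar f 0)
                    <= K2 * Rabs (x (S j) u)).
      { pose proof (Hg (x (S j) u) 0) as A. rewrite Rminus_0_r in A.
        apply A; [now apply Rabs_le_between|lra]. }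
      (* The remainder collects the net force and the gain change times [v' - vstar]. Both are
         linear in the net force, since the gain is Lipschitz and speeds are bounded in [Omega]. *)
      assert (Hr : exists r, dw (S j) u = - omega * w (S j) u + r /\
                 r ^ 2 <= (1 + K2 * vmax) ^ 2 * (4 * K1 ^ 2 * S2)).
      { exists (x (S j) u
                - (g vmax vstar f (x (S j) u) - g vmax vstar f 0) * (v' (S j) u - vstar)).
        split; [unfold dw, omega, w; ring|].
        apply Rle_trans with (((1 + K2 * vmax) * Rabs (x (S j) u)) ^ 2).
        - rewrite <- pow2_abs. apply pow_incr; split; [apply Rabs_pos|].
          unfold Rminus at 1. eapply Rle_trans; [apply Rabs_triang|].
          rewrite Rabs_Ropp, Rabs_mult.
          assert (Rabs (g vmax vstar f (x (S j) u) - g vmax vstar f 0)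
                  * Rabs (v' (S j) u - vstar) <= K2 * Rabs (x (S j) u) * vmax)
            by (apply Rmult_le_compat; try apply Rabs_pos; assumption).
          lra.
        - rewrite Rpow_mult_distr, pow2_abs.
          apply Rmult_le_compat_l; [apply pow2_ge_0|exact Hxs']. }
      destruct Hr as [r [Hdw Hr]].
      (* Damping has a favourable sign and is dropped; then [2 * w * r <= w^2 + r^2]. *)
      assert (Hwpart : 2 * w (S j) u * dw (S j) u
                <= S2 + (1 + K2 * vmax) ^ 2 * (4 * K1 ^ 2 * S2)).
      { rewrite Hdw. pose proof (HS (S j) ltac:(lia)).
        pose proof (pow2_ge_0 (zz (S j) u)). pose proof (pow2_ge_0 (w (S j) u - r)).
        assert (0 <= omega * (w (S j) u) ^ 2) by (apply Rmult_le_pos; [lra|nra]).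
        nra. }
      (* With the names set below, [2 * a * (c - b) <= a^2 + 2 * b^2 + 2 * c^2], and each square is
         at most [S2]. *)
      assert (Hzpart : 2 * zz (S j) u * dzz (S j) u <= 5 * S2).
      { destruct (Compare_dec.le_dec 2 (S j)) as [H2|H2].
        - rewrite Hdzz by lia.
          pose proof (HS (S j) ltac:(lia)). pose proof (HS (S j - 1)%nat ltac:(lia)).
          set (a := zz (S j) u) in *. set (b := w (S j) u) in *.
          set (c := w (S j - 1)%nat u) in *.
          pose proof (pow2_ge_0 (zz (S j - 1)%nat u)).
          pose proof (pow2_ge_0 (a - (c - b))). pose proof (pow2_ge_0 (c + b)).
          nra.
        - replace j with 0%nat by lia. unfold zz. simpl. lra. }
      unfold de. lra.
    - intros j Hj. unfold e, w. rewrite Hv0 by lia.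
      destruct (Compare_dec.le_dec 2 (S j)) as [H2|H2].
      + rewrite Hzz by exact H2. unfold z. rewrite Hs0 by lia. ring.
      + replace j with 0%nat by lia. unfold zz. simpl. ring. }
  assert (Hfin : forall i, (1 <= i <= n)%nat -> w i t = 0 /\ zz i t = 0).
  { intros i Hi. specialize (Hz (i - 1)%nat ltac:(lia)). unfold e in Hz.
    replace (S (i - 1)) with i in Hz by lia. apply Rplus_sqr_eq_0 in Hz. exact Hz. }
  split; intros i Hi.
  - destruct (Hfin i ltac:(lia)) as [_ A]. rewrite Hzz in A by lia. unfold z in A. lra.
  - destruct (Hfin i Hi) as [A _]. unfold w in A. lra.
Qed.

(** * The explicit solution *)

Lemma exp_neg_bounds (a t : R) : 0 <= a -> 0 <= t -> 0 < exp (- a * t) <= 1.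
Proof.
  intros Ha Ht. split; [apply exp_pos|].
  rewrite <- exp_0.
  destruct (Rle_lt_or_eq (- a * t) 0) as [H|H]; [nra| |].
  - now apply Rlt_le, exp_increasing.
  - rewrite H; lra.
Qed.

Theorem proposition3p1 (n : nat) (mu lam L vmax vstar : R) (V f : R -> R)
    (s0 v0 : nat -> R)
    (hn : (2 <= n)%nat)
    (hmu : 0 < mu)
    (hlam : lam > L) (hL : L > 0)
    (hvmax : vmax > vstar) (hvstar : vstar > 0)
    (hV : admissible_potential L lam V)
    (hf : admissible_f f)
    (hinit : Omega n L vmax s0 v0) :
  let omega := mu + g vmax vstar f 0 in
  (forall i, (2 <= i <= n)%nat ->
     s0 i >= Rmax (lam - / omega * (v0 (i - 1)%nat - v0 i)) lam) ->
  is_the_acc_solution n mu L vmax vstar V f s0 v0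
    (fun i t => s0 i + / omega * (v0 (i - 1)%nat - v0 i) * (1 - exp (- omega * t)))
    (fun i t => vstar + exp (- omega * t) * (v0 i - vstar)).
Proof.
  intros omega hs.
  assert (Hom : 0 < omega) by (apply omega_pos; [exact hmu|lra|exact hf]).
  set (s := fun (i : nat) t => _). set (v := fun (i : nat) t => _).
  assert (Hfree : forall i u, (2 <= i <= n)%nat -> 0 <= u -> lam <= s i u).
  { intros i u Hi Hu. unfold s.
    pose proof (hs i Hi) as H.
    pose proof (Rmax_l (lam - / omega * (v0 (i - 1)%nat - v0 i)) lam).
    pose proof (Rmax_r (lam - / omega * (v0 (i - 1)%nat - v0 i)) lam).
    pose proof (exp_neg_bounds omega u ltac:(lra) Hu).
    set (c := / omega * (v0 (i - 1)%nat - v0 i)) in *.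
    (* The headway is the convex combination of [s0 i] and its limit [s0 i + c] with weights [q] and
       [1 - q]; [hs] puts both at or above [lam]. *)
    set (q := exp (- omega * u)) in *. nra. }
  assert (HdV : forall i u, (2 <= i <= n)%nat -> 0 <= u -> Derive V (s i u) = 0).
  { intros i u Hi Hu. apply (Derive_potential_eq_0 L lam V); [lra|exact hV|].
    now apply Hfree. }
  assert (Hdv : forall i u, is_derive (v i) u (- omega * (v i u - vstar))).
  { intros i u. unfold v. auto_derive; [trivial|ring]. }
  assert (Hsol : acc_solution n mu L vmax vstar V f p_infty s v).
  { intros t [Ht _].
    split; [split; [|split]|split; [|split; [|split]]].
    - intros i Hi. pose proof (Hfree i t Hi Ht). simpl. lra.
    (* Each velocity is a convex combination of [vstar] and [v0 i], both in [0, vmax]. *)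
    - intros i Hi. destruct hinit as (_ & Hup & Hlo).
      specialize (Hup i Hi). specialize (Hlo i Hi).
      pose proof (exp_neg_bounds omega t ltac:(lra) Ht). unfold v. nra.
    - intros i Hi. destruct hinit as (_ & Hup & Hlo).
      specialize (Hup i Hi). specialize (Hlo i Hi).
      pose proof (exp_neg_bounds omega t ltac:(lra) Ht). unfold v. nra.
    - intros i Hi. apply is_derive_D_in. unfold s, v.
      auto_derive; [trivial|field; lra].
    - apply is_derive_D_in. cbv beta. unfold k_first.
      (* Without interaction every gain is [mu + g 0], that is [omega], leaving the linear equation
         [Hdv]. *)
      rewrite HdV by (lia || exact Ht).
      replace (- 0) with 0 by ring. rewrite Rminus_0_r. apply Hdv.
    - intros i Hi. apply is_derive_D_in. cbv beta. unfold k_mid.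
      rewrite !HdV by (lia || exact Ht).
      rewrite Rplus_0_r, !Rminus_0_r. apply Hdv.
    - apply is_derive_D_in. cbv beta. unfold k_last.
      rewrite HdV by (lia || exact Ht).
      rewrite Rplus_0_r. apply Hdv. }
  assert (Hinit : initial_condition n s0 v0 s v).
  { split; intros i Hi; unfold s, v; rewrite Rmult_0_r, exp_0; ring. }
  split; [exact Hsol|split; [exact Hinit|]].
  intros T s' v' _ Hsol' [Hs0 Hv0] t Ht.
  apply (acc_solution_free_flow_unique n mu lam L vmax vstar V f T s v s' v' t);
    try assumption; try (fold omega; lra).
  - now apply acc_solution_restrict.
  - intros i Hi. rewrite Hs0 by exact Hi. symmetry. now apply Hinit.
  - intros i Hi. rewrite Hv0 by exact Hi. symmetry. now apply Hinit.
Qed.
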